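(* The class $\mathcal K$ of compact fuzzy metric spaces is strictly contained in the class $\mathcal L$ of Lebesgue fuzzy metric spaces, $\mathcal K\subsetneq\mathcal L$; that is, every compact fuzzy metric space is Lebesgue, and there exists a Lebesgue fuzzy metric space that is not compact.
   Context: A continuous $t$-norm is a binary operation $*$ on $[0,1]$ that is associative, commutative, continuous on $[0,1]\times[0,1]$, satisfies $a*1=a$ for all $a\in[0,1]$, and satisfies $a*c\le b*d$ whenever $a\le b$ and $c\le d$. A fuzzy metric space (George–Veeramani) is a triple $(X,M,* )$ where $X$ is a non-empty set, $*$ is a continuous $t$-norm and $M:X\times X\times(0,\infty)\to[0,1]$ satisfies, for all $x,y,z\in X$ and $s,t>0$: (a) $M(x,y,t)>0$; (b) $M(x,y,t)=1$ if and only if $x=y$; (c) $M(x,y,t)=M(y,x,t)$; (d) $M(x,y,t)*M(y,z,s)\le M(x,z,t+s)$; (e) $M(x,y,\cdot):(0,\infty)\to[0,1]$ is continuous. For $x\in X$, $r\in(0,1)$, $t>0$ put $B_M(x,r,t)=\{y\in X: M(x,y,t)>1-r\}$; these sets form a base of a topology $\tau_M$ on $X$. A fuzzy metric space $(X,M,* )$ is compact if the topological space $(X,\tau_M)$ is compact. It is Lebesgue if for every open cover $\mathcal G_0$ of $(X,\tau_M)$ there exist $r\in(0,1)$ and $t>0$ such that each $B_M(x,r,t)$, $x\in X$, is contained in some member of $\mathcal G_0$. *)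

(* Defs.v *)
From HB Require Import structures.
From mathcomp Require Import all_boot all_order all_algebra.
From mathcomp Require Import all_classical all_reals all_analysis.

Set Implicit Arguments.
Unset Strict Implicit.
Unset Printing Implicit Defensive.

Import Order.TTheory GRing.Theory Num.Theory.
Import numFieldNormedType.Exports.

Local Open Scope classical_set_scope.
Local Open Scope ring_scope.

(* Operations on [0,1] and functions on (0,+oo) are represented by total
   functions on R; their values outside of these domains are unconstrained. *)

Record continuousTNorm (R : realType) := ContinuousTNorm {
  tnorm :> R -> R -> R ;
  tnorm_itv : forall a b, a \in `[0, 1] -> b \in `[0, 1] ->
    tnorm a b \in `[0, 1] ;
  tnormA : forall a b c,
    a \in `[0, 1] -> b \in `[0, 1] -> c \in `[0, 1] ->
    tnorm a (tnorm b c) = tnorm (tnorm a b) c ;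
  tnormC : forall a b, a \in `[0, 1] -> b \in `[0, 1] ->
    tnorm a b = tnorm b a ;
  tnorm_continuous :
    {within `[0, 1] `*` `[0, 1],
      continuous (fun ab : R * R => tnorm ab.1 ab.2)} ;
  tnorm1 : forall a, a \in `[0, 1] -> tnorm a 1 = a ;
  ler_tnorm : forall a b c d,
    a \in `[0, 1] -> b \in `[0, 1] -> c \in `[0, 1] -> d \in `[0, 1] ->
    a <= b -> c <= d -> tnorm a c <= tnorm b d
}.

Record fuzzyMetricSpace (R : realType) := FuzzyMetricSpace {
  fm_sort :> Type ;
  fm_nonempty : inhabited fm_sort ;
  fm_tnorm : continuousTNorm R ;
  fm_metric : fm_sort -> fm_sort -> R -> R ;
  fm_itv : forall x y t, 0 < t -> fm_metric x y t \in `[0, 1] ;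
  fm_gt0 : forall x y t, 0 < t -> 0 < fm_metric x y t ;
  fm_eq1 : forall x y t, 0 < t -> fm_metric x y t = 1 <-> x = y ;
  fm_sym : forall x y t, 0 < t -> fm_metric x y t = fm_metric y x t ;
  fm_triangle : forall x y z s t, 0 < s -> 0 < t ->
    fm_tnorm (fm_metric x y t) (fm_metric y z s) <= fm_metric x z (t + s) ;
  fm_continuous : forall x y,
    {within `]0, +oo[, continuous (fm_metric x y)}
}.

Lemma tnorm_near1 (R : realType) (T : continuousTNorm R) (a c : R) :
  a \in `[0, 1] -> c < a ->
  exists2 e, 0 < e < 1 & forall b, b \in `[0, 1] -> 1 - e < b -> c < T a b.
Proof.
move=> aI ca; have cT := @tnorm_continuous R T.
have I1 : (1 : R) \in `[0, 1] by rewrite in_itv /= ler01 lexx.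
have a1I : (`[0, 1]%classic `*` `[0, 1]%classic) (a, 1 : R) by split.
have /subspace_continuousP/(_ _ a1I) := cT.
rewrite /from_subspace /= (tnorm1 _ aI) => /cvgrPdist_lt /(_ (a - c)).
rewrite subr_gt0 => /(_ ca).
rewrite near_withinE => /nbhs_ballP[d /= d0 dP].
exists (Num.min d (2^-1)).
  by rewrite lt_min d0 invr_gt0 ltr0n /= gt_min invf_lt1// ltr1n orbT.
move=> b bI be; have := dP (a, b).
have b1 : b <= 1 by move: bI; rewrite in_itv /= => /andP[].
have abd : ball ((a, 1) : R * R) d (a, b).
  split; first exact: ballxx.
  rewrite /= /ball /= ger0_norm ?subr_ge0// ltrBlDr -ltrBlDl.
  by rewrite (le_lt_trans _ be)// lerD2l lerN2 ge_min lexx.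
have abI : (`[0, 1]%classic `*` `[0, 1]%classic) (a, b : R) by split.
move=> /(_ abd abI) /= /(le_lt_trans (ler_norm _)).
by rewrite ltrD2l ltrN2.
Qed.

Section FuzzyTopology.
Variables (R : realType) (X : fuzzyMetricSpace R).
Implicit Types (x y : X) (r t : R).

Definition fm_ball x r t : set X := [set y | 1 - r < fm_metric x y t].

Definition fm_balls : set (set X) :=
  [set B | exists x r t, [/\ 0 < r < 1, 0 < t & B = fm_ball x r t]].

Lemma fm_ball_center x r t : 0 < r -> 0 < t -> fm_ball x r t x.
Proof.
move=> r0 t0; rewrite /fm_ball /=.
by have /(_ erefl) -> := (fm_eq1 x x t0).2; rewrite ltrBlDr ltrDl.
Qed.

Lemma fm_metric_homo x y s t : 0 < s -> s <= t ->
  fm_metric x y s <= fm_metric x y t.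
Proof.
move=> s0; rewrite le_eqVlt => /predU1P[->//|st].
have ts0 : 0 < t - s by rewrite subr_gt0.
have := fm_triangle x y y ts0 s0.
have /(_ erefl) -> := (fm_eq1 y y ts0).2.
by rewrite (tnorm1 _ (fm_itv _ _ s0)) addrC subrK.
Qed.

Lemma fm_metric_left x y t c : 0 < t -> c < fm_metric x y t ->
  exists2 s, 0 < s < t & c < fm_metric x y s.
Proof.
move=> t0 ct; have tI : `]0, +oo[%classic t by rewrite /= in_itv /= t0.
have /subspace_continuousP/(_ _ tI) := @fm_continuous R X x y.
rewrite /from_subspace => /cvgrPdist_lt /(_ (fm_metric x y t - c)).
rewrite subr_gt0 => /(_ ct).
rewrite near_withinE => /nbhs_ballP[d /= d0 dP].
pose e := Num.min d t / 2.
have m0 : 0 < Num.min d t by rewrite lt_min d0 t0.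
have e0 : 0 < e by rewrite divr_gt0.
have em : e < Num.min d t by rewrite /e ltr_pdivrMr// ltr_pMr// ltr1n.
have et : e < t by rewrite (lt_le_trans em)// ge_min lexx orbT.
have ed : e < d by rewrite (lt_le_trans em)// ge_min lexx.
have te0 : 0 < t - e by rewrite subr_gt0.
exists (t - e); first by rewrite te0 ltrBlDr ltrDl.
have := dP (t - e).
have bd : ball t d (t - e) by rewrite /ball /= opprB addrC subrK gtr0_norm.
have teI : `]0, +oo[%classic (t - e) by rewrite /= in_itv /= te0.
move=> /(_ bd teI) /= /(le_lt_trans (ler_norm _)).
by rewrite ltrD2l ltrN2.
Qed.

Lemma fm_ball_nested x r t y : 0 < t -> fm_ball x r t y ->
  exists r' t', [/\ 0 < r' < 1, 0 < t' & fm_ball y r' t' `<=` fm_ball x r t].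
Proof.
move=> t0 /= /(fm_metric_left t0)[s /andP[s0 st] xys].
have [e e01 eP] := tnorm_near1 (fm_tnorm X) (fm_itv x y s0) xys.
have ts0 : 0 < t - s by rewrite subr_gt0.
exists e, (t - s); split => // z /= yz.
have := fm_triangle x y z ts0 s0.
rewrite [s + _]addrC subrK; apply: lt_le_trans.
exact: eP (fm_itv _ _ ts0) yz.
Qed.

Lemma fm_ball_shrink x r r' t t' : 0 < t' -> r' <= r -> t' <= t ->
  fm_ball x r' t' `<=` fm_ball x r t.
Proof.
move=> t'0 rr tt y /= yr.
apply: lt_le_trans (fm_metric_homo _ _ t'0 tt).
by apply: le_lt_trans yr; rewrite lerD2l lerN2.
Qed.

Lemma fm_balls_cover : \bigcup_(B in fm_balls) B = [set: X].
Proof.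
rewrite -subTset => x _; exists (fm_ball x 2^-1 1).
  exists x, 2^-1, 1; split => //.
  by rewrite invr_gt0 ltr0n /= invf_lt1// ltr1n.
by apply: fm_ball_center; rewrite ?invr_gt0.
Qed.

Lemma fm_balls_join (B C : set X) x : fm_balls B -> fm_balls C ->
  B x -> C x ->
  exists D : set X, [/\ fm_balls D, D x & D `<=` B `&` C].
Proof.
move=> [y [r [t [_ t0 ->]]]] [z [q [u [_ u0 ->]]]].
move=> /(fm_ball_nested t0)[r1 [t1 [/andP[r10 r11] t10 s1]]].
move=> /(fm_ball_nested u0)[r2 [t2 [/andP[r20 r21] t20 s2]]].
have m0 : 0 < Num.min t1 t2 by rewrite lt_min t10 t20.
have r0 : 0 < Num.min r1 r2 by rewrite lt_min r10 r20.
exists (fm_ball x (Num.min r1 r2) (Num.min t1 t2)); split.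
- exists x, (Num.min r1 r2), (Num.min t1 t2); split=> //.
  by rewrite r0 gt_min r11.
- exact: fm_ball_center.
- move=> w wB; split.
  + by apply/s1/(fm_ball_shrink m0 _ _ wB); rewrite ge_min lexx.
  + by apply/s2/(fm_ball_shrink m0 _ _ wB); rewrite ge_min lexx orbT.
Qed.

HB.instance Definition _ := gen_eqMixin (fm_sort X).
HB.instance Definition _ := gen_choiceMixin (fm_sort X).
HB.instance Definition _ := isBaseTopological.Build (fm_sort X)
  fm_balls_cover fm_balls_join.

Lemma fm_openE (A : set X) :
  open A <-> exists2 D, D `<=` fm_balls & \bigcup_(B in D) B = A.
Proof. by []. Qed.

End FuzzyTopology.

Definition compactFuzzy (R : realType) : set (fuzzyMetricSpace R) :=
  [set X : fuzzyMetricSpace R | compact [set: X]].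

Definition lebesgueFuzzy (R : realType) : set (fuzzyMetricSpace R) :=
  [set X : fuzzyMetricSpace R | forall G : set (set X),
    (forall U, G U -> open U) -> \bigcup_(U in G) U = [set: X] ->
    exists r t : R, [/\ 0 < r < 1, 0 < t &
      forall x : X, exists2 U, G U & fm_ball x r t `<=` U]].

Arguments compactFuzzy : clear implicits.
Arguments lebesgueFuzzy : clear implicits.

(* Main.v *)
Require Import Defs.
From mathcomp Require Import all_boot all_order all_algebra.
From mathcomp Require Import all_classical all_reals all_analysis.
From mathcomp Require Import lra.

Set Implicit Arguments.
Unset Strict Implicit.
Unset Printing Implicit Defensive.

Import Order.TTheory GRing.Theory Num.Theory.
Import numFieldNormedType.Exports.

Local Open Scope classical_set_scope.
Local Open Scope ring_scope.

(** A compact space is Lebesgue because each point [x] of a member [U] of an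
    open cover has a neighborhood all of whose points [y] satisfy
    [fm_ball y e e `<=` U] for every small [e] (continuity of the t-norm at
    [(a, 1)]); by compactness one [e] then works for all [y]. The inclusion is
    strict because of an infinite set with [M x y t = 1/2] for [x <> y], where
    the balls of radius [1/2] are singletons. *)

Section FuzzyBalls.
Variables (R : realType) (X : fuzzyMetricSpace R).

Lemma fm_ball_open (x : X) (r t : R) :
  0 < r < 1 -> 0 < t -> open (fm_ball x r t).
Proof.
move=> r01 t0; apply/fm_openE; exists [set fm_ball x r t].
  by move=> _ ->; exists x, r, t.
by rewrite bigcup_set1.
Qed.

Lemma fm_ball_nbhs (x : X) (r t : R) :
  0 < r < 1 -> 0 < t -> nbhs x (fm_ball x r t).
Proof.
move=> r01 t0; apply: open_nbhs_nbhs; split; first exact: fm_ball_open.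
by apply: fm_ball_center => //; case/andP: r01.
Qed.

(** A basic ball inside [U] that contains [x] may have another center; [fm_ball_nested] recenters it
    at [x]. *)
Lemma open_fm_ball (U : set X) (x : X) : open U -> U x ->
  exists r t : R, [/\ 0 < r < 1, 0 < t & fm_ball x r t `<=` U].
Proof.
move=> /fm_openE[D DB <-] [B DB' Bx].
have [y [q [u [_ u0 BE]]]] := DB _ DB'.
move: Bx; rewrite {1}BE => /(fm_ball_nested u0)[r [t [r01 t0 sB]]].
by exists r, t; split=> // z /sB zB; exists B; rewrite // BE.
Qed.

(** Splitting [t] into halves in the triangle inequality bounds [M x z t] below by a t-norm value
    near [(a, 1)], with [a > 1 - r]. The radius [e] does not depend on [y]. *)
Lemma fm_ball_trans (x : X) (r t : R) : 0 < r -> 0 < t ->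
  exists2 e, 0 < e < 1 & forall y, (1 - e < fm_metric x y (t / 2)) ->
    fm_ball y e (t / 2) `<=` fm_ball x r t.
Proof.
move=> r0 t0; have t20 : 0 < t / 2 by rewrite divr_gt0.
(* Capping [r] at 1 keeps [a = 1 - q / 2] in [[0, 1]], while still [1 - r < a]. *)
pose q := Num.min r 1.
have q0 : 0 < q by rewrite lt_min r0 ltr01.
have q1 : q <= 1 by rewrite ge_min lexx orbT.
have qr : q <= r by rewrite ge_min lexx.
have aI : 1 - q / 2 \in `[0, 1] by rewrite in_itv /=; lra.
have [|e /andP[e0 e1] eP] := @tnorm_near1 R (fm_tnorm X) _ (1 - r) aI.
  by lra.
(* The bound [q / 2] gives [a <= M x y (t / 2)]; the bound [e] makes [M y z (t / 2)] close enough to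
   1. *)
exists (Num.min e (q / 2)).
  by rewrite lt_min e0 gt_min e1 divr_gt0.
rewrite /fm_ball => y xy z /= yz.
have xyI := fm_itv x y t20; have yzI := fm_itv y z t20.
have := fm_triangle x y z t20 t20; rewrite -splitr; apply: lt_le_trans.
have qe : Num.min e (q / 2) <= q / 2 by rewrite ge_min lexx orbT.
have ee : Num.min e (q / 2) <= e by rewrite ge_min lexx.
apply: (lt_le_trans (eP _ yzI _)); first by lra.
by apply: ler_tnorm => //; lra.
Qed.

Lemma compact_lebesgueFuzzy : compactFuzzy R X -> lebesgueFuzzy R X.
Proof.
move=> /compact_near_coveringP cX G Gopen Gcover.
pose P (e : R) (y : X) := exists2 U, G U & fm_ball y e e `<=` U.
(* Near-covering form of compactness, for the filter of right neighborhoods of 0: local validity of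
   [P e y] in both variables yields one [e] for all [y]. *)
have : \forall e \near 0^'+, [set: X] `<=` P e.
  apply: cX => x _.
  have [U GU Ux] : (\bigcup_(U in G) U) x by rewrite Gcover.
  have [r [t [/andP[r0 _] t0 sU]]] := open_fm_ball (Gopen _ GU) Ux.
  have [d d01 dP] := fm_ball_trans x r0 t0.
  have t20 : 0 < t / 2 by rewrite divr_gt0.
  have m0 : 0 < Num.min d (t / 2) by case/andP: d01 => d0 _; rewrite lt_min d0.
  exists (fm_ball x d (t / 2), [set e | 0 < e < Num.min d (t / 2)]).
    split; first exact: fm_ball_nbhs.
    near=> e; apply/andP; split; near: e; [exact: nbhs_right_gt|].
    exact: nbhs_right_lt.
  move=> [y e] [/= xy /andP[e0]]; rewrite lt_min => /andP[ed et].
  exists U => //; apply: subset_trans (subset_trans (dP y xy) sU).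
  by apply: fm_ball_shrink => //; exact: ltW.
move=> eP.
have : \forall e \near (0 : R)^'+, (0 < e < 1) /\ [set: X] `<=` P e.
  near=> e; split; last by near: e.
  by apply/andP; split; near: e; [exact: nbhs_right_gt|exact: nbhs_right_lt].
move=> /filter_ex[e [e01 XP]]; exists e, e; split=> //; first by case/andP: e01.
by move=> x; exact: XP.
Unshelve. all: by end_near. Qed.

End FuzzyBalls.

Section DiscreteSpace.
Variable R : realType.

Definition prodTNorm : continuousTNorm R.
Proof.
apply: (@ContinuousTNorm R (fun a b => a * b)).
- by move=> a b; rewrite !in_itv /= => /andP[? ?] /andP[? ?]; apply/andP; nra.
- by move=> a b c _ _ _; rewrite mulrA.
- by move=> a b _ _; rewrite mulrC.
- apply: continuous_subspaceT => ab.
  by apply: cvgM; [exact: cvg_fst|exact: cvg_snd].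
- by move=> a _; rewrite mulr1.
- move=> a b c d; rewrite !in_itv /= => /andP[a0 _] _ /andP[c0 _] _.
  exact: ler_pM.
Defined.

Definition discreteMetric (m n : nat) (t : R) : R :=
  if m == n then 1 else 2^-1.

Definition discreteFuzzy : fuzzyMetricSpace R.
Proof.
apply: (@FuzzyMetricSpace R nat (inhabits 0%N) prodTNorm discreteMetric);
  rewrite /discreteMetric.
- by move=> x y t _; rewrite in_itv /=; case: ifP => _; lra.
- by move=> x y t _; case: ifP => _; lra.
- have half_neq1 : (2^-1 : R) <> 1 by lra.
  by move=> x y t _; case: eqP.
- by move=> x y t _; rewrite eq_sym.
(* For [x <> y] the product is at most 1/2, the least value of the metric. *)
- move=> x y z s t _ _ /=.
  have [->|xy] := eqVneq x y; first by rewrite mul1r.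
  by case: ifP => _; case: ifP => _; lra.
- by move=> x y; exact/continuous_subspaceT/cst_continuous.
Defined.

Lemma discreteFuzzy_ball (x : discreteFuzzy) (t : R) :
  fm_ball x 2^-1 t = [set x].
Proof.
have halfE : 1 - 2^-1 = 2^-1 :> R by lra.
have half_lt1 : 2^-1 < 1 :> R by lra.
apply/seteqP; split=> y; rewrite /fm_ball /= /discreteMetric halfE.
  by case: eqP => // _; rewrite ltxx.
by move=> ->; rewrite eqxx.
Qed.

Let half_itv : 0 < (2^-1 : R) < 1.
Proof. by lra. Qed.

Lemma discreteFuzzy_lebesgue : lebesgueFuzzy R discreteFuzzy.
Proof.
move=> G _ Gcover; exists 2^-1, 1; split=> // x.
have [U GU Ux] : (\bigcup_(U in G) U) x by rewrite Gcover.
by exists U => //; rewrite discreteFuzzy_ball => _ ->.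
Qed.

Lemma discreteFuzzy_not_compact : ~ compactFuzzy R discreteFuzzy.
Proof.
(* The filter at infinity has no cluster point: the neighborhood [[set p]] misses the integers above
   [p]. *)
move=> /(_ (\oo : set_system nat) _ filterT)[p [_ clp]].
have pN := fm_ball_nbhs p half_itv ltr01.
rewrite discreteFuzzy_ball in pN.
have [q [/= pq qp]] := clp _ _ (nbhs_infty_gt (p : nat)) pN.
by move: pq; rewrite qp ltnn.
Qed.

End DiscreteSpace.

Theorem mainTheorem5 (R : realType) :
  compactFuzzy R `<=` lebesgueFuzzy R /\
  (exists X : fuzzyMetricSpace R, lebesgueFuzzy R X /\ ~ compactFuzzy R X).
Proof.
split; first exact: compact_lebesgueFuzzy.
exists (discreteFuzzy R); split.
  exact: discreteFuzzy_lebesgue.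
exact: discreteFuzzy_not_compact.
Qed.
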